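(* Let $k,s$ be nonzero integers, let $t\in\{s^2,-s^2\}$, and let $n\ge 1$ be an integer. Let $P$ be one of the polynomials $F^{(k,t)}_n$, $L^{(k,t)}_n$, and assume that one of the following four cases holds: (i) $t=s^2$, $P=F^{(k,t)}_n$, and $n$ is odd; (ii) $t=s^2$, $P=L^{(k,t)}_n$, and $n$ is even with $n\ge 2$; (iii) $t=-s^2$, $P=F^{(k,t)}_n$, with $n\ge1$ arbitrary; (iv) $t=-s^2$, $P=L^{(k,t)}_n$, with $n\ge 1$ arbitrary. Let $f$ be an irreducible factor of $P$ over $\mathbb{Q}$, let $x\in\overline{\mathbb{Q}}$ be a root of $f$, and set $\theta:=\dfrac{k\,x}{s}$. Then $\theta$ is an algebraic integer, $\mathbb{Q}(\theta)=\mathbb{Q}(x)$, and $\mathcal{O}_{\mathbb{Q}(x)}=\mathbb{Z}[\theta]$. Moreover, there exists a root of unity $\xi$ such that $\theta=\xi-\xi^{-1}$ in cases (i) and (ii), and $\theta=\xi+\xi^{-1}$ in cases (iii) and (iv).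
   Context: All roots are taken in a fixed algebraic closure $\overline{\mathbb{Q}}\subset\mathbb{C}$ of $\mathbb{Q}$, and $\mathcal{O}_K$ denotes the ring of integers of a number field $K$. For $k,t\in\mathbb{Z}$, the $(k,t)$-Fibonacci polynomials $F^{(k,t)}_n\in\mathbb{Z}[X]$ and the $(k,t)$-Lucas polynomials $L^{(k,t)}_n\in\mathbb{Z}[X]$, $n\ge0$, are defined by $$F^{(k,t)}_0=0,\quad F^{(k,t)}_1=1,\quad F^{(k,t)}_{n+2}=kX\,F^{(k,t)}_{n+1}+t\,F^{(k,t)}_n,$$ $$L^{(k,t)}_0=2,\quad L^{(k,t)}_1=kX,\quad L^{(k,t)}_{n+2}=kX\,L^{(k,t)}_{n+1}+t\,L^{(k,t)}_n.$$ Irreducible factors are nonconstant. *)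

(* Defs.v *)
From mathcomp Require Import all_boot all_order all_algebra all_field.

Set Implicit Arguments.
Unset Strict Implicit.
Unset Printing Implicit Defensive.

Import Order.TTheory GRing.Theory Num.Theory.
Local Open Scope ring_scope.

Fixpoint fibonacci_poly (k t : int) (n : nat) : {poly int} :=
  if n is m.+1 then
    if m is p.+1
    then k *: 'X * fibonacci_poly k t m + t *: fibonacci_poly k t p
    else 1
  else 0.

Fixpoint lucas_poly (k t : int) (n : nat) : {poly int} :=
  if n is m.+1 then
    if m is p.+1
    then k *: 'X * lucas_poly k t m + t *: lucas_poly k t p
    else k *: 'X
  else 2.

Definition case_i (k t s : int) (n : nat) (P : {poly int}) : Prop :=
  [/\ t = s ^+ 2, P = fibonacci_poly k t n & odd n].

Definition case_ii (k t s : int) (n : nat) (P : {poly int}) : Prop :=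
  [/\ t = s ^+ 2, P = lucas_poly k t n, ~~ odd n & (2 <= n)%N].

Definition case_iii (k t s : int) (n : nat) (P : {poly int}) : Prop :=
  [/\ t = - s ^+ 2, P = fibonacci_poly k t n & (1 <= n)%N].

Definition case_iv (k t s : int) (n : nat) (P : {poly int}) : Prop :=
  [/\ t = - s ^+ 2, P = lucas_poly k t n & (1 <= n)%N].

(* [f] is a factor of [P] over the rationals; [irreducible_poly] already
   excludes constants. *)
Definition irreducible_factor (f : {poly rat}) (P : {poly int}) : Prop :=
  irreducible_poly f /\ f %| map_poly intr P.

(* Q(x), as the set of values at x of the rational fractions over Q that are
   defined at x. *)
Definition Q_adjoin (x : algC) : algC -> Prop := fun y =>
  exists p q : {poly rat},
    (map_poly ratr q).[x] != 0 /\
    y = (map_poly ratr p).[x] / (map_poly ratr q).[x].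

(* Z[x], as the image of the evaluation at x. *)
Definition Z_adjoin (x : algC) : algC -> Prop := fun y =>
  exists p : {poly int}, y = (map_poly intr p).[x].

Definition integers_of (K : algC -> Prop) : algC -> Prop := fun y =>
  K y /\ y \in Aint.

(* The exponent must be positive: [0.-unity_root] holds everywhere. *)
Definition is_root_of_unity (xi : algC) : Prop :=
  exists2 m : nat, (0 < m)%N & m.-unity_root xi.

(* Main.v *)
Require Import Defs.
From mathcomp Require Import all_boot all_order all_algebra all_field.
From mathcomp Require Import cyclic ring.

(** Write theta = z + d / z with d = -1 when t = s^2 and d = 1 when t = -s^2.
    By the Binet formulas [P(x) = 0] forces z^(4n) = 1.

    The ring Z[z] of any root of unity z is integrally closed in Q(z), one prime
    p at a time: for suitable j, z^(p^j) = z w with w of p-power order, so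
    raising to the power p^j is the identity of Z[z] modulo l = 1 - w (or l = p
    if w = 1). Hence Z[z]/(l) is reduced; if y is integral and l y lies in Z[z],
    then l y is nilpotent in Z[z]/(l), so y lies in Z[z]. Since a power of l is
    divisible by p, the same holds with p in place of l.

    Finally z and d / z are Galois conjugate and Z[z] = Z[theta] + z Z[theta].
    An integer y = a + z b of Q(theta) is fixed by the automorphism exchanging
    z and d / z, which gives b = 0. *)

Set Implicit Arguments.
Unset Strict Implicit.

Import Order.TTheory GRing.Theory Num.Theory.
Local Open Scope ring_scope.

(** * Frobenius congruences modulo a prime *)

Lemma exprD_prime (A : comNzRingType) (p : nat) (a b : A) :
  prime p -> exists c, (a + b) ^+ p = a ^+ p + b ^+ p + c *+ p.
Proof.
case: p => [|[|p]] // p_pr.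
have binE (i : 'I_p.+1) : 'C(p.+2, i.+1) = ('C(p.+2, i.+1) %/ p.+2 * p.+2)%N.
  by rewrite divnK // prime_dvd_bin //= ltnS; case: i.
exists (\sum_(i < p.+1) a ^+ (p.+2 - i.+1) * b ^+ i.+1 *+
          ('C(p.+2, i.+1) %/ p.+2)).
rewrite exprDn big_ord_recl big_ord_recr /= subn0 subnn !expr0 mulr1 mul1r.
rewrite bin0 binn !mulr1n -addrA; congr (_ + _); rewrite addrC; congr (_ + _).
rewrite -sumrMnl; apply: eq_bigr => i _; rewrite -mulrnA /bump /= add1n.
by rewrite {1}binE.
Qed.

Lemma int_exp_prime (p : nat) (c : int) :
  prime p -> exists d, c ^+ p = c + d *+ p.
Proof.
move=> p_pr; have p_gt0 := prime_gt0 p_pr.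
have nat_case (n : nat) : exists d : int, n%:Z ^+ p = n%:Z + d *+ p.
  elim: n => [|n [d IHn]].
    by exists 0; rewrite expr0n eqn0Ngt p_gt0 mul0rn addr0.
  have [e De] := @exprD_prime _ p n%:Z 1 p_pr.
  exists (d + e); rewrite intS [1 + _]addrC De expr1n IHn mulrnDl; ring.
case: (intP c) => [|n|n]; [exact: (nat_case 0)|exact: nat_case|].
have [d Dd] := nat_case n.+1.
(* Expanding (c + (-c))^p = 0 settles negative integers without a case split on the parity of p. *)
have [e De] := @exprD_prime _ p n.+1%:Z (- n.+1%:Z) p_pr.
exists (- d - e); apply/eqP; rewrite -subr_eq0; apply/eqP.
move: De; rewrite subrr expr0n eqn0Ngt p_gt0 Dd /= mulrnBl mulNrn => De.
apply: etrans (esym De); ring.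
Qed.

(** Modulo p, raising to the power p is additive, and it fixes the coefficients by Fermat's little
    theorem. *)
Lemma poly_exp_prime (p : nat) (g : {poly int}) :
  prime p -> exists h, g ^+ p = g \Po 'X^p + h *+ p.
Proof.
move=> p_pr; elim/poly_ind: g => [|g c [h IHg]].
  by exists 0; rewrite expr0n eqn0Ngt prime_gt0 // comp_poly0 mul0rn addr0.
have [e De] := @exprD_prime _ p (g * 'X) c%:P p_pr.
have [d Dd] := @int_exp_prime p c p_pr.
exists (h * 'X^p + d%:P + e); rewrite De exprMn IHg -rmorphXn /= Dd.
rewrite comp_polyD comp_polyM comp_polyX comp_polyC !mulrnDl.
rewrite polyCD polyCMn mulrDl mulrnAl; ring.
Qed.

Lemma poly_exp_primeX (p j : nat) (g : {poly int}) :
  prime p -> exists h, g ^+ (p ^ j) = g \Po 'X^(p ^ j) + h *+ p.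
Proof.
move=> p_pr; elim: j => [|j [h IHj]].
  by exists 0; rewrite expn0 !expr1 comp_polyXr mul0rn addr0.
rewrite expnSr exprM IHj.
have [c Dc] := @exprD_prime _ p (g \Po 'X^(p ^ j)) (h *+ p) p_pr.
have [d Dd] := @poly_exp_prime p (g \Po 'X^(p ^ j)) p_pr.
have Dp : (h *+ p) ^+ p = (h * (h *+ p) ^+ p.-1) *+ p.
  by rewrite -mulrnAl -exprS prednK ?prime_gt0.
exists (d + h * (h *+ p) ^+ p.-1 + c); rewrite Dc Dd Dp !mulrnDl !addrA.
by rewrite -comp_polyA comp_Xn_poly -exprM mulnC.
Qed.

(** * Values of integer polynomials *)

(** Packaged as a ring morphism, with image Z[z]; membership in Z[z] is always expressed as being a
    value of [zeval z]. *)
Definition zeval (z : algC) : {rmorphism {poly int} -> algC} :=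
  horner_eval z \o map_poly intr.

Lemma zevalE z p : zeval z p = (map_poly intr p).[z].
Proof. by []. Qed.

Lemma zevalX z : zeval z 'X = z.
Proof. by rewrite zevalE map_polyX hornerX. Qed.

Lemma zevalC z c : zeval z c%:P = c%:~R.
Proof. by rewrite zevalE map_polyC hornerC. Qed.

Lemma zeval_comp z p q : zeval z (p \Po q) = zeval (zeval z q) p.
Proof. by rewrite zevalE map_comp_poly horner_comp. Qed.

Lemma zeval_Aint z p : z \in Aint -> zeval z p \in Aint.
Proof.
move=> zA; elim/poly_ind: p => [|p c IHp]; first by rewrite rmorph0 rpred0.
by rewrite rmorphD rmorphM zevalX zevalC rpredD ?rpredM ?Aint_int.
Qed.

Lemma Aint_monic_root (y : algC) :
  y \in Aint -> exists2 q : {poly int}, q \is monic & zeval y q = 0.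
Proof.
move=> /floorpP[q Dq]; exists q; last first.
  by rewrite zevalE -Dq; apply/rootP; apply: root_minCpoly.
have:= minCpoly_monic y; rewrite Dq !monicE lead_coef_map_inj //; last first.
  exact: intr_inj.
by rewrite -[1]/(1%:~R) eqr_int.
Qed.

(** * Integral closedness of Z[z] for a root of unity z *)

(** The q-th power map is the identity on Z[z]/(l), so this ring is reduced. A monic equation of y,
    multiplied by a power of l, shows that l y is nilpotent there; hence l y lies in l Z[z], and l
    cancels. *)
Lemma zeval_reduced_div (z y : algC) (l g : {poly int}) (q : nat) :
    (1 < q)%N -> zeval z l != 0 ->
    (forall h, exists r, zeval z h ^+ q = zeval z h + zeval z l * zeval z r) ->
    y \in Aint -> zeval z l * y = zeval z g ->
  exists h, y = zeval z h.
Proof.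
move=> q_gt1 l_neq0 powq yA ly_g.
have powqX e : exists r,
    zeval z g ^+ (q ^ e) = zeval z g + zeval z l * zeval z r.
  elim: e => [|e [r IHe]]; first by exists 0; rewrite rmorph0 mulr0 addr0.
  have [r' Dr'] := powq (g ^+ (q ^ e)).
  exists (r + r'); rewrite expnSr exprM -rmorphXn Dr' rmorphXn IHe rmorphD; ring.
have [Q Qmonic Qy] := Aint_monic_root yA.
set d := (size Q).-1.
have sizeQ : size Q = d.+1 by rewrite prednK // size_poly_gt0 monic_neq0.
have [R DR] : exists R, zeval z g ^+ d = zeval z l * zeval z R.
  (* This is l^(d-1) y^d, with y^d expanded by the monic equation and each l^i y^i replaced by
     g^i. *)
  exists (- \sum_(i < d) (Q`_i)%:P * l ^+ (d.-1 - i) * g ^+ i).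
  rewrite -ly_g exprMn.
  have -> : y ^+ d = - \sum_(i < d) (Q`_i)%:~R * y ^+ i.
    apply/eqP; rewrite -addr_eq0 -[X in _ == X]Qy zevalE.
    rewrite horner_coef size_map_inj_poly //; last exact: intr_inj.
    rewrite sizeQ big_ord_recr coef_map /= -/d.
    move: Qmonic; rewrite monicE /lead_coef -/d => /eqP->.
    rewrite mul1r addrC; apply/eqP; congr (_ + _).
    by apply: eq_bigr => i _; rewrite coef_map.
  rewrite rmorphN rmorph_sum !mulrN !mulr_sumr; congr (- _).
  apply: eq_bigr => i _; rewrite !rmorphM !rmorphXn zevalC -ly_g exprMn.
  have -> : zeval z l ^+ d
      = zeval z l * zeval z l ^+ (d.-1 - i) * zeval z l ^+ i.
    have d_gt0 : (0 < d)%N by apply: leq_trans (ltn_ord i).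
    by rewrite -exprS -exprD addSn subnK ?prednK // -ltnS prednK.
  ring.
have [r Dr] := powqX d.
(* As q^d > d, the power g^(q^d) is a multiple of g^d, hence of l; it is also congruent to g modulo
   l. *)
exists (R * g ^+ (q ^ d - d) - r); apply: (mulfI l_neq0).
rewrite ly_g rmorphB rmorphM rmorphXn mulrBr mulrA -DR -exprD.
by rewrite subnKC ?Dr ?addrK // ltnW // ltn_expl.
Qed.

(** The factors l are removed one at a time, since each l^i y is again integral. *)
Lemma zeval_reduced_divX (z y : algC) (l g : {poly int}) (q M : nat) :
    z \in Aint -> (1 < q)%N -> zeval z l != 0 ->
    (forall h, exists r, zeval z h ^+ q = zeval z h + zeval z l * zeval z r) ->
    y \in Aint -> zeval z l ^+ M * y = zeval z g ->
  exists h, y = zeval z h.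
Proof.
move=> zA q_gt1 l_neq0 powq yA; elim: M g => [|M IHM] g.
  by rewrite mul1r; exists g.
rewrite exprS -mulrA => ly_g.
have lyA : zeval z l ^+ M * y \in Aint by rewrite rpredM ?rpredX ?zeval_Aint.
have [h Dh] := @zeval_reduced_div z _ l g q q_gt1 l_neq0 powq lyA ly_g.
exact: IHM Dh.
Qed.

Lemma comp_poly_cong (g u v : {poly int}) :
  exists r, g \Po u = g \Po v + (u - v) * r.
Proof.
elim/poly_ind: g => [|g c [r IHg]].
  by exists 0; rewrite !comp_poly0 mulr0 addr0.
exists (g \Po v + r * u).
rewrite !comp_polyD !comp_polyM !comp_polyX !comp_polyC IHg; ring.
Qed.

(** Some power v of w satisfies v^p = 1 and v != 1. The powers v^i with i < p then sum to 0, so p is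
    the sum of the 1 - v^i, each divisible by 1 - w. *)
Lemma prime_dvd_1_sub_unity_root (p b : nat) (w : algC) :
  prime p -> w != 1 -> w ^+ (p ^ b) = 1 ->
  exists r, p%:R = (1 - w) * zeval w r.
Proof.
move=> p_pr; elim: b w => [|b IHb] w w_neq1.
  by rewrite expr1 => /eqP/idPn.
have [wb1|wb_neq1 w_b] := eqVneq (w ^+ (p ^ b)) 1; first by move=> _; apply: IHb.
have dvd1 (i : nat) : exists r, 1 - w ^+ i = (1 - w) * zeval w r.
  exists (\sum_(j < i) 'X^j); rewrite -{1}(expr1n _ i) subrXX; congr (_ * _).
  rewrite rmorph_sum; apply: eq_bigr => j _.
  by rewrite expr1n mul1r rmorphXn zevalX.
have sum0 : \sum_(i < p) (w ^+ (p ^ b)) ^+ i = 0.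
  apply/eqP; move: (subrX1 (w ^+ (p ^ b)) p); rewrite -exprM -expnSr w_b subrr.
  by move/eqP; rewrite eq_sym mulf_eq0 subr_eq0 (negPf wb_neq1).
have -> : p%:R = \sum_(i < p) (1 - w ^+ (p ^ b * i)).
  rewrite sumrB sumr_const card_ord; under eq_bigr => i _ do rewrite exprM.
  by rewrite sum0 subr0.
suff partial_sum k : exists r,
    \sum_(i < k) (1 - w ^+ (p ^ b * i)) = (1 - w) * zeval w r by [].
elim: k => [|m [r Dr]]; first by exists 0; rewrite big_ord0 rmorph0 mulr0.
have [r' Dr'] := dvd1 (p ^ b * m)%N.
by exists (r + r'); rewrite rmorphD mulrDr -Dr -Dr' big_ord_recr.
Qed.

Lemma zeval_prime_div (z y : algC) (N p : nat) (g : {poly int}) :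
    (0 < N)%N -> z ^+ N = 1 -> prime p ->
    y \in Aint -> p%:R * y = zeval z g ->
  exists h, y = zeval z h.
Proof.
move=> N_gt0 zN p_pr yA py_g; have p_gt1 := prime_gt1 p_pr.
have zA : z \in Aint by apply: (@Aint_unity_root N) => //; apply/unity_rootP.
have [m co_pm DN] := pfactor_coprime p_pr N_gt0.
(* A positive multiple of the totient of m: by Euler, m divides p^j - 1, so w = z^(p^j - 1) has
   order dividing p^a. *)
set a := logn p N in DN; pose j := (totient m * a.+1)%N.
have m_gt0 : (0 < m)%N by move: N_gt0; rewrite DN muln_gt0 => /andP[].
have q_gt1 : (1 < p ^ j)%N.
  by rewrite -{1}(expn0 p) ltn_exp2l // muln_gt0 totient_gt0 m_gt0.
have m_dvd : (m %| p ^ j - 1)%N.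
  rewrite -eqn_mod_dvd ?(ltnW q_gt1) // /j expnM -modnXm.
  by rewrite Euler_exp_totient // modnXm exp1n.
pose w := z ^+ (p ^ j - 1).
have zq : z ^+ (p ^ j) = z * w by rewrite -exprS subn1 prednK // ltnW.
have wa : w ^+ (p ^ a) = 1.
  have [c Dc] := dvdnP m_dvd.
  by rewrite /w -exprM Dc -mulnA -DN mulnC exprM zN expr1n.
(* Modulo p the left side is h(z w), and z w - z = - z (1 - w). *)
have frob h : exists r r', zeval z h ^+ (p ^ j)
    = zeval z h + (1 - w) * zeval z r + p%:R * zeval z r'.
  have [r' Dr'] := @poly_exp_primeX p j h p_pr.
  have [r Dr] := comp_poly_cong h 'X^(p ^ j) 'X.
  exists (- 'X * r), r'.
  rewrite -rmorphXn Dr' Dr comp_polyXr !rmorphD !rmorphM rmorphB rmorphN.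
  rewrite rmorphXn rmorphMn !zevalX zq -mulr_natl; ring.
have [w1|w_neq1] := eqVneq w 1.
  have pE : zeval z p%:R = p%:R by rewrite rmorph_nat.
  apply: (@zeval_reduced_div z y p%:R g (p ^ j)) => //; rewrite pE //.
    by rewrite pnatr_eq0 -lt0n prime_gt0.
  move=> h; have [r [r' ->]] := frob h.
  by exists r'; rewrite w1 subrr mul0r addr0.
have w_pow : exists W, zeval z W = w.
  by exists ('X^(p ^ j - 1)); rewrite rmorphXn zevalX.
have [W DW] := w_pow.
have lE : zeval z (1 - W) = 1 - w by rewrite rmorphB rmorph1 DW.
have [s Ds] := @prime_dvd_1_sub_unity_root p a w p_pr w_neq1 wa.
(* At w this gives (1 - w)^(p^a) = 1 - w^(p^a) + p t(w) = p t(w), which turns p y in Z[z] into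
   l^(p^a) y in Z[z]. *)
have [t Dt] := @poly_exp_primeX p a (1 - 'X) p_pr.
apply: (@zeval_reduced_divX z y (1 - W) ((t \Po W) * g) (p ^ j) (p ^ a)) => //.
- by rewrite lE subr_eq0 eq_sym.
- move=> h; have [r [r' ->]] := frob h.
  exists (r + (s \Po W) * r').
  by rewrite lE Ds -DW rmorphD rmorphM zeval_comp; ring.
rewrite rmorphM -py_g zeval_comp DW mulrA; congr (_ * y).
have : zeval w ((1 - 'X) ^+ (p ^ a)) = zeval w t * p%:R.
  rewrite Dt rmorphD rmorphMn zeval_comp rmorphXn !rmorphB !rmorph1 !zevalX wa.
  by rewrite subrr add0r mulr_natr.
by rewrite rmorphXn rmorphB rmorph1 zevalX lE.
Qed.

(** Every element of Q(z) is some g(z) / D; the prime factors of D are cancelled one by one. *)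
Lemma zeval_integrally_closed (z y : algC) (N D : nat) (g : {poly int}) :
    (0 < N)%N -> z ^+ N = 1 -> (0 < D)%N ->
    y \in Aint -> D%:R * y = zeval z g ->
  exists h, y = zeval z h.
Proof.
move=> N_gt0 zN; elim/ltn_ind: D g => D IHD g D_gt0 yA Dy_g.
have [D_le1|D_gt1] := leqP D 1.
  exists g; have -> : zeval z g = 1 * y; last by rewrite mul1r.
  by rewrite -Dy_g; case: D D_gt0 D_le1 {IHD Dy_g} => [|[]].
have p_pr := pdiv_prime D_gt1; have p_gt1 := prime_gt1 p_pr.
have DD : D = (pdiv D * (D %/ pdiv D))%N by rewrite mulnC divnK ?pdiv_dvd.
have D'_gt0 : (0 < D %/ pdiv D)%N.
  by rewrite divn_gt0 ?pdiv_gt0 // dvdn_leq ?pdiv_dvd.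
have [||h Dh] :=
  @zeval_prime_div z ((D %/ pdiv D)%:R * y) N (pdiv D) g N_gt0 zN p_pr.
- by rewrite rpredM // rpred_nat.
- by rewrite mulrA -natrM -DD.
exact: (IHD (D %/ pdiv D)%N (ltn_Pdiv p_gt1 D_gt0) h).
Qed.

(** * Galois descent from Z[z] to Z[theta] *)

(** The relation z^2 = (z + w) z - d reduces every power of z to degree at most 1 over Z[z + w]. *)
Lemma zeval_span_conj (z w : algC) (d : int) (p : {poly int}) :
  z * w = d%:~R ->
  exists a b, zeval z p = zeval (z + w) a + z * zeval (z + w) b.
Proof.
move=> zw; elim/poly_ind: p => [|p c [a [b IHp]]].
  by exists 0, 0; rewrite !rmorph0 mulr0 addr0.
exists (c%:P - d%:P * b), (a + 'X * b).
rewrite !(rmorphD, rmorphM, rmorphN) IHp !zevalC !zevalX -zw; ring.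
Qed.

Lemma rmorph_horner_ratr (u : {rmorphism algC -> algC}) (p : {poly rat})
    (x : algC) :
  u (map_poly ratr p).[x] = (map_poly ratr p).[u x].
Proof.
rewrite -horner_map -map_poly_comp; congr _.[_].
by apply: eq_map_poly => c /=; rewrite fmorph_rat.
Qed.

Lemma rmorph_zeval (u : {rmorphism algC -> algC}) (p : {poly int}) (x : algC) :
  u (zeval x p) = zeval (u x) p.
Proof.
rewrite !zevalE -horner_map -map_poly_comp; congr _.[_].
by apply: eq_map_poly => c /=; rewrite rmorph_int.
Qed.

Lemma Aint_rat_poly_conj_sum (z : algC) (N e : nat) (d : int) (p : {poly rat}) :
    (0 < N)%N -> z ^+ N = 1 -> coprime e N ->
    z * z ^+ e = d%:~R -> z ^+ e != z ->
  let theta := z + z ^+ e in let y := (map_poly ratr p).[theta] in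
  y \in Aint -> exists h, y = zeval theta h.
Proof.
move=> N_gt0 zN co_eN zw w_neq_z theta y yA.
have [u Du] := Qn_aut_exists co_eN.
have uz : u z = z ^+ e by apply: Du.
have z_neq0 : z != 0.
  by apply: contra_eq_neq zN => ->; rewrite expr0n eqn0Ngt N_gt0 eq_sym oner_neq0.
have utheta : u theta = theta.
  rewrite /theta rmorphD uz addrC; congr (_ + _).
  have w_neq0 : z ^+ e != 0 by rewrite expf_neq0.
  (* The integer d = z z^e is fixed by u, and u z = z^e, so u sends z^e back to z. *)
  by apply: (mulfI w_neq0); rewrite -{1}uz -rmorphM zw rmorph_int -zw mulrC.
have [q [a a_neq0 Dp]] := rat_poly_scale p.
have aC_neq0 : a%:~R != 0 :> algC by rewrite intr_eq0.
have ay : a%:~R * y = zeval theta q.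
  rewrite /y Dp map_polyZ hornerZ fmorphV rmorph_int mulVKf // zevalE.
  rewrite -map_poly_comp; congr _.[_].
  by apply: eq_map_poly => c /=; rewrite rmorph_int.
have thetaE : theta = zeval z ('X + 'X^e) by rewrite rmorphD rmorphXn zevalX.
have [h Dh] : exists h, y = zeval z h.
  (* The denominator must be a natural number, so the sign of a goes into the polynomial. *)
  apply: (@zeval_integrally_closed z y N `|a|
            ((Num.sg a)%:P * (q \Po ('X + 'X^e)))) => //.
    by rewrite absz_gt0.
  by rewrite rmorphM zevalC zeval_comp -thetaE -ay mulrA -intrM -abszEsg.
have [b [c Dy]] := zeval_span_conj h zw.
have uy : u y = y by rewrite rmorph_horner_ratr utheta.
exists b; rewrite Dh Dy -/theta; apply/eqP; rewrite -subr_eq0 addrC addKr.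
rewrite mulf_eq0 (negPf z_neq0) /=.
(* Applying u to y = b(theta) + z c(theta) gives (z^e - z) c(theta) = 0. *)
move: uy; rewrite Dh Dy -/theta rmorphD rmorphM !rmorph_zeval utheta uz.
move/addrI/eqP; rewrite -subr_eq0 -mulrBl mulf_eq0 subr_eq0.
by rewrite (negPf w_neq_z).
Qed.

(** * Binet formulas *)

Section BinetFormulas.

(** [a] and [b] are the roots of T^2 - k x T - t, the characteristic polynomial of both recurrences
    at x. *)
Variables (k t : int) (x a b : algC).
Hypotheses (abD : a + b = k%:~R * x) (abM : a * b = - t%:~R).

Lemma zeval_fibonacciSS n : zeval x (fibonacci_poly k t n.+2) =
  (a + b) * zeval x (fibonacci_poly k t n.+1)
  - a * b * zeval x (fibonacci_poly k t n).
Proof.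
rewrite -[fibonacci_poly k t n.+2]/(k *: 'X * fibonacci_poly k t n.+1 +
   t *: fibonacci_poly k t n).
rewrite -!mul_polyC !(rmorphD, rmorphM) !zevalC zevalX abD abM; ring.
Qed.

Lemma zeval_lucasSS n : zeval x (lucas_poly k t n.+2) =
  (a + b) * zeval x (lucas_poly k t n.+1) - a * b * zeval x (lucas_poly k t n).
Proof.
rewrite -[lucas_poly k t n.+2]/(k *: 'X * lucas_poly k t n.+1 +
   t *: lucas_poly k t n).
rewrite -!mul_polyC !(rmorphD, rmorphM) !zevalC zevalX abD abM; ring.
Qed.

Lemma fibonacci_binet n :
  zeval x (fibonacci_poly k t n) * (a - b) = a ^+ n - b ^+ n.
Proof.
elim/ltn_ind: n => [[|[|n]] IHn].
- by rewrite rmorph0 mul0r subrr.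
- by rewrite rmorph1 mul1r.
rewrite zeval_fibonacciSS mulrBl -!mulrA !IHn // !exprS; ring.
Qed.

Lemma lucas_binet n : zeval x (lucas_poly k t n) = a ^+ n + b ^+ n.
Proof.
elim/ltn_ind: n => [[|[|n]] IHn].
- by rewrite rmorph_nat.
- by rewrite -[lucas_poly k t 1]/(k *: 'X) -mul_polyC rmorphM zevalC zevalX abD.
rewrite zeval_lucasSS !IHn // !exprS; ring.
Qed.

(** For a double characteristic root [fibonacci_binet] only says 0 = 0; this value, nonzero when a
    is, serves to rule that case out at a root. *)
Lemma fibonacci_binet_eq n :
  a = b -> zeval x (fibonacci_poly k t n.+1) = n.+1%:R * a ^+ n.
Proof.
move=> ab; elim/ltn_ind: n => [[|[|n]] IHn].
- by rewrite rmorph1 mulr1.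
- by rewrite zeval_fibonacciSS rmorph0 rmorph1 -ab; ring.
by rewrite zeval_fibonacciSS !IHn // -ab !exprS -!natr1; ring.
Qed.

End BinetFormulas.

(** * The field Q(x) *)

Lemma Q_adjoin_scale (c : rat) (x y : algC) :
  Q_adjoin (ratr c * x) y -> Q_adjoin x y.
Proof.
have compE (p : {poly rat}) :
    (map_poly ratr (p \Po (c *: 'X))).[x] = (map_poly ratr p).[ratr c * x].
  by rewrite map_comp_poly horner_comp map_polyZ map_polyX hornerZ hornerX.
move=> [p [q [q_neq0 ->]]]; exists (p \Po (c *: 'X)), (q \Po (c *: 'X)).
by rewrite !compE.
Qed.

(** A denominator q with q(x) != 0 is prime to the irreducible f, so a Bezout relation inverts it
    modulo f. *)
Lemma Q_adjoin_poly (f : {poly rat}) (x y : algC) :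
    irreducible_poly f -> root (map_poly ratr f) x -> Q_adjoin x y ->
  exists g : {poly rat}, y = (map_poly ratr g).[x].
Proof.
move=> f_irr /rootP fx0 [p [q [qx_neq0 ->]]].
have /Bezout_eq1_coprimepP[[u v] /= uv1] : coprimep f q.
  rewrite irreducible_poly_coprime //; apply: contra qx_neq0 => /dvdpP[r ->].
  by rewrite rmorphM hornerM fx0 mulr0.
exists (p * v); rewrite rmorphM hornerM; congr (_ * _).
apply: (mulIf qx_neq0); rewrite mulVf // -hornerM -rmorphM.
have -> : v * q = 1 - u * f by rewrite -uv1 addrC addKr.
rewrite rmorphB rmorphM rmorph1 hornerD hornerN hornerM fx0 mulr0 subr0.
by rewrite hornerC.
Qed.

(** * Roots of the polynomials in terms of roots of unity *)

Lemma conj_sum_exists (theta d : algC) :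
  d != 0 -> exists2 z, z != 0 & theta = z + d / z.
Proof.
move=> d_neq0; pose r := sqrtC (theta ^+ 2 - 4 * d).
have Dr : r ^+ 2 = theta ^+ 2 - 4 * d by apply: sqrtCK.
pose z := (theta + r) / 2; pose w := (theta - r) / 2.
have zw : z * w = d.
  have -> : z * w = (theta ^+ 2 - r ^+ 2) / 4 by rewrite /z /w; field.
  by rewrite Dr; field.
have z_neq0 : z != 0 by apply: contraNneq d_neq0 => z0; rewrite -zw z0 mul0r.
by exists z => //; rewrite -zw [z * w]mulrC mulfK // /z /w; field.
Qed.

Section RootShape.

Variables (k s t : int) (d : algC) (n : nat) (x : algC).
Hypotheses (s_neq0 : s != 0) (d_neq0 : d != 0).
(** Used with d = -1 for t = s^2 and d = 1 for t = - s^2; then s z and s d / z are the two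
    characteristic roots. *)
Hypotheses (Dt : t%:~R = - (d * s%:~R ^+ 2)).

Let theta := k%:~R * x / s%:~R.
Let sC_neq0 : s%:~R != 0 :> algC. Proof. by rewrite intr_eq0. Qed.

Let binet_hyps z : z != 0 -> theta = z + d / z ->
  s%:~R * z + s%:~R * (d / z) = k%:~R * x /\
  s%:~R * z * (s%:~R * (d / z)) = - t%:~R :> algC.
Proof.
move=> z_neq0 Dtheta; split; last by rewrite Dt; field.
by rewrite -mulrDr -Dtheta mulrC divfK.
Qed.

(** By Binet z^n = (d / z)^n. If d / z = z, the value at x would be n (s z)^(n-1), which is
    nonzero. *)
Lemma fibonacci_root_shape :
    (0 < n)%N -> zeval x (fibonacci_poly k t n) = 0 ->
  exists z, [/\ theta = z + d / z, d / z != z & z ^+ (2 * n) = d ^+ n].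
Proof.
case: n => // m _ Fx0; have [z z_neq0 Dtheta] := conj_sum_exists theta d_neq0.
have [abD abM] := binet_hyps z_neq0 Dtheta.
exists z; split=> //.
  apply/eqP => dz.
  have /eqP : m.+1%:R * (s%:~R * z) ^+ m = 0 :> algC.
    by rewrite -(fibonacci_binet_eq abD abM) ?dz.
  rewrite mulf_eq0 pnatr_eq0 expf_eq0 mulf_eq0 (negPf sC_neq0) (negPf z_neq0).
  by rewrite andbF.
have := fibonacci_binet abD abM m.+1.
rewrite Fx0 mul0r 2!exprMn -mulrBr => /esym/eqP.
rewrite mulf_eq0 expf_eq0 (negPf sC_neq0) andbF /= subr_eq0 => /eqP zn.
by rewrite mulSn mul1n exprD {2}zn -exprMn mulrC divfK.
Qed.

(** By Binet z^n = - (d / z)^n; if d / z = z, this would give 2 z^n = 0. *)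
Lemma lucas_root_shape :
    zeval x (lucas_poly k t n) = 0 ->
  exists z, [/\ theta = z + d / z, d / z != z & z ^+ (2 * n) = - d ^+ n].
Proof.
move=> Lx0; have [z z_neq0 Dtheta] := conj_sum_exists theta d_neq0.
have [abD abM] := binet_hyps z_neq0 Dtheta.
have := lucas_binet abD abM n.
rewrite Lx0 2!exprMn -mulrDr => /esym/eqP.
rewrite mulf_eq0 expf_eq0 (negPf sC_neq0) andbF /= addr_eq0 => /eqP zn.
exists z; split=> //.
  apply/eqP => dz; move/eqP: zn; rewrite dz -addr_eq0 -mulr2n mulrn_eq0 /=.
  by rewrite expf_eq0 (negPf z_neq0) andbF.
by rewrite mulSn mul1n exprD {2}zn mulrN -exprMn mulrC divfK.
Qed.

End RootShape.

(** * The ring of integers of Q(x) *)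

(** Makes 2n - 1 a Galois exponent on 4n-th roots of unity, as needed for d = -1. *)
Lemma coprime_pred_double (n : nat) : (0 < n)%N -> coprime (2 * n).-1 (4 * n).
Proof.
case: n => // m _; rewrite mulnS /=.
have -> : (4 * m.+1 = 2 * (1 + 2 * m) + 2)%N by ring.
by rewrite /coprime gcdnMDl -/(coprime _ _) coprimen2 add1n /= mul2n odd_double.
Qed.

Theorem theorem1p2 (k s t : int) (n : nat) (P : {poly int})
    (f : {poly rat}) (x : algC)
    (k_neq0 : k != 0) (s_neq0 : s != 0)
    (t_sqr : t = s ^+ 2 \/ t = - s ^+ 2)
    (n_ge1 : (1 <= n)%N)
    (P_def : P = fibonacci_poly k t n \/ P = lucas_poly k t n)
    (P_case : [\/ case_i k t s n P, case_ii k t s n P,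
                  case_iii k t s n P | case_iv k t s n P])
    (f_factor : irreducible_factor f P)
    (x_root : root (map_poly ratr f) x) :
  let theta : algC := k%:~R * x / s%:~R in
  [/\ theta \in Aint,
      (forall y : algC, Q_adjoin theta y <-> Q_adjoin x y),
      (forall y : algC, integers_of (Q_adjoin x) y <-> Z_adjoin theta y),
      (case_i k t s n P \/ case_ii k t s n P ->
         exists xi : algC, is_root_of_unity xi /\ theta = xi - xi^-1)
    & (case_iii k t s n P \/ case_iv k t s n P ->
         exists xi : algC, is_root_of_unity xi /\ theta = xi + xi^-1)].
Proof.
move=> theta; have [f_irr f_dvd] := f_factor.
have Px0 : zeval x P = 0.
  have /dvdpP[r Dr] := f_dvd.
  have -> : zeval x P = (map_poly ratr (map_poly intr P : {poly rat})).[x].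
    rewrite zevalE -map_poly_comp; congr _.[_].
    by apply: eq_map_poly => c /=; rewrite rmorph_int.
  by rewrite Dr rmorphM hornerM (rootP x_root) mulr0.
have kC_neq0 : k%:~R != 0 :> algC by rewrite intr_eq0.
have sC_neq0 : s%:~R != 0 :> algC by rewrite intr_eq0.
have thetaE : theta = ratr (k%:~R / s%:~R) * x.
  by rewrite fmorph_div !rmorph_int /theta mulrAC.
have xE : x = ratr (s%:~R / k%:~R) * theta.
  by rewrite fmorph_div !rmorph_int /theta; field; apply/andP.
have QE y : Q_adjoin theta y <-> Q_adjoin x y.
  split; first by rewrite thetaE; apply: Q_adjoin_scale.
  by rewrite {1}xE; apply: Q_adjoin_scale.
(* The two signs of t exclude each other, so the case at hand determines d. *)
have t_neq : s ^+ 2 != - s ^+ 2.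
  by rewrite -addr_eq0 -mulr2n mulrn_eq0 expf_eq0 (negPf s_neq0).
(* In cases (i) and (ii) the parity of n makes z^(2n) equal to -1. *)
have [d [z [d_case Dtheta z_neq z2n]]] : exists (d : int) (z : algC),
    [/\ d = 1 /\ t = - s ^+ 2 \/ d = -1 /\ t = s ^+ 2,
       theta = z + d%:~R / z, d%:~R / z != z
     & z ^+ (2 * n) = -1 \/ d = 1 /\ z ^+ (2 * n) = 1].
  have tE (d : int) : t = - (d * s ^+ 2) -> t%:~R = - (d%:~R * s%:~R ^+ 2) :> algC.
    by move=> ->; rewrite rmorphN rmorphM rmorphXn.
  have m1_neq0 : (-1)%:~R != 0 :> algC by rewrite intr_eq0.
  have p1_neq0 : 1%:~R != 0 :> algC by rewrite intr_eq0.
  case: P_case => [[Dt DP n_odd]|[Dt DP n_even _]|[Dt DP _]|[Dt DP _]].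
  - have Dt' := tE (-1) (_ : t = - (-1 * s ^+ 2)).
    rewrite mulN1r opprK in Dt'; rewrite DP in Px0.
    have [z [? ? z2n]] := fibonacci_root_shape s_neq0 m1_neq0 (Dt' Dt) n_ge1 Px0.
    exists (-1), z; split; [by right|by []|by []|left].
    by rewrite z2n rmorphN1 -signr_odd n_odd.
  - have Dt' := tE (-1) (_ : t = - (-1 * s ^+ 2)).
    rewrite mulN1r opprK in Dt'; rewrite DP in Px0.
    have [z [? ? z2n]] := lucas_root_shape s_neq0 m1_neq0 (Dt' Dt) Px0.
    exists (-1), z; split; [by right|by []|by []|left].
    by rewrite z2n rmorphN1 -signr_odd (negPf n_even).
  - have Dt' := tE 1 (_ : t = - (1 * s ^+ 2)).
    rewrite mul1r in Dt'; rewrite DP in Px0.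
    have [z [? ? z2n]] := fibonacci_root_shape s_neq0 p1_neq0 (Dt' Dt) n_ge1 Px0.
    exists 1, z; split; [by left|by []|by []|right].
    by rewrite z2n expr1n.
  - have Dt' := tE 1 (_ : t = - (1 * s ^+ 2)).
    rewrite mul1r in Dt'; rewrite DP in Px0.
    have [z [? ? z2n]] := lucas_root_shape s_neq0 p1_neq0 (Dt' Dt) Px0.
    exists 1, z; split; [by left|by []|by []|left].
    by rewrite z2n expr1n.
have N_gt0 : (0 < 4 * n)%N by rewrite muln_gt0.
have zN : z ^+ (4 * n) = 1.
  have -> : (4 * n = 2 * n * 2)%N by ring.
  rewrite exprM.
  by case: z2n => [|[_]] ->; rewrite ?sqrrN expr1n.
have z_neq0 : z != 0.
  by apply: contra_eq_neq zN => ->; rewrite expr0n eqn0Ngt N_gt0 eq_sym oner_neq0.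
(* The conjugate d / z is a power of z: for d = 1 the exponent is -1 modulo 4n, for d = -1 it is 2n
   - 1 because z^(2n) = -1. *)
have [e co_eN ze] : exists2 e, coprime e (4 * n) & z ^+ e = d%:~R / z.
  case: d_case => -[Dd _].
    exists (4 * n).-1.
      by rewrite -{2}(prednK N_gt0) coprime_sym coprimeSn.
    by apply: (mulfI z_neq0); rewrite -exprS prednK // zN Dd mulrC divfK.
  have z2nN1 : z ^+ (2 * n) = -1 by case: z2n => // -[]; rewrite Dd.
  exists (2 * n).-1; first exact: coprime_pred_double.
  by apply: (mulfI z_neq0); rewrite -exprS prednK ?muln_gt0 // z2nN1 Dd mulrC divfK.
have zA : z \in Aint by apply: (Aint_unity_root N_gt0); apply/unity_rootP.
have thetaA : theta \in Aint by rewrite Dtheta -ze rpredD ?rpredX.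
have z_unity : is_root_of_unity z.
  by exists (4 * n)%N => //; apply/unity_rootP.
split=> // [y||].
- split=> [[Qy yA]|[p ->]].
    have [g Dg] := Q_adjoin_poly f_irr x_root Qy.
    (* Substituting x = (s / k) theta makes y a rational polynomial in theta. *)
    have Dy : y = (map_poly ratr (g \Po ((s%:~R / k%:~R) *: 'X))).[theta].
      by rewrite map_comp_poly horner_comp map_polyZ map_polyX hornerZ hornerX -xE.
    have zze : z * z ^+ e = d%:~R by rewrite ze mulrC divfK.
    have ze_neq : z ^+ e != z by rewrite ze.
    have thetaD : theta = z + z ^+ e by rewrite ze.
    rewrite Dy thetaD in yA *.
    exact: Aint_rat_poly_conj_sum N_gt0 zN co_eN zze ze_neq yA.
  split; last exact: zeval_Aint.
  apply/QE; exists (map_poly intr p), 1; rewrite rmorph1 hornerC oner_neq0 divr1.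
  split=> //; rewrite -map_poly_comp; congr _.[_].
  by apply: eq_map_poly => c /=; rewrite rmorph_int.
- move=> tcase; exists z; split=> //; rewrite Dtheta.
  case: d_case => -[-> Dt]; last by rewrite mulN1r.
  by case: tcase => -[Dt']; move: t_neq; rewrite -Dt -Dt' eqxx.
move=> tcase; exists z; split=> //; rewrite Dtheta.
case: d_case => -[-> Dt]; first by rewrite mul1r.
by case: tcase => -[Dt']; move: t_neq; rewrite -Dt' -Dt eqxx.
Qed.
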